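(* Let $n\ge2$, let $0<\lambda_1<\cdots<\lambda_n$, and suppose $$0<\delta<\min\left\{\lambda_1,\ \frac12\min_{1\le j<n}(\lambda_{j+1}-\lambda_j)\right\}.$$ Define $E=\bigcup_{j=1}^n[\lambda_j-\delta,\lambda_j+\delta]$. Let $\ell_0,\ldots,\ell_n$ be the Lagrange basis polynomials for the nodes $x_0=0$ and $x_j=\lambda_j$ ($1\le j\le n$), and set $$\Lambda(\delta)=1+\sum_{j=1}^n|\ell_j(\lambda_n+\delta)| .$$ Every polynomial $q$ of degree at most $n$ satisfying $q(0)=1$ obeys $$\max_{x\in E}|q(x)|\ge\frac{|\ell_0(\lambda_n+\delta)|}{\Lambda(\delta)}=\frac{\delta}{\lambda_n\Lambda(\delta)}\prod_{j=1}^{n-1}\left(\frac{\lambda_n+\delta}{\lambda_j}-1\right).$$ For fixed nodes, $\Lambda(\delta)\to2$ as $\delta\to0$.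
   Context: The Lagrange basis polynomial $\ell_i$ is the polynomial of degree at most $n$ with $\ell_i(x_j)=1$ if $i=j$ and $0$ otherwise, for the $n+1$ nodes $x_0,\dots,x_n$. Polynomials have real coefficients. *)

(* Defs.v *)
From HB Require Import structures.
From mathcomp Require Import all_boot all_order all_algebra.
From mathcomp Require Import all_classical all_reals all_analysis.

Set Implicit Arguments.
Unset Strict Implicit.
Unset Printing Implicit Defensive.

Import Order.TTheory GRing.Theory Num.Theory.
Import numFieldNormedType.Exports.

Local Open Scope classical_set_scope.
Local Open Scope ring_scope.

Definition is_max (R : realType) (A : set R) (m : R) : Prop :=
  A m /\ ubound A m.

(* The reals lambda_1, ..., lambda_n are given by a function lam : nat -> R
   indexed from 1; lam 0 and the lam j with j > n are never used. *)

(* The idle element lam 2 - lam 1 is the term j = 1, so for 2 <= n this is the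
   minimum of lambda_{j+1} - lambda_j over 1 <= j < n. *)
Definition min_gap (R : realType) (n : nat) (lam : nat -> R) : R :=
  \big[Num.min/lam 2%N - lam 1%N]_(1 <= j < n) (lam j.+1 - lam j).

Definition bands (R : realType) (n : nat) (lam : nat -> R) (delta : R) :
    set R :=
  \bigcup_(j in [set j : nat | (1 <= j <= n)%N])
    `[lam j - delta, lam j + delta]%classic.

Definition node (R : realType) (lam : nat -> R) (j : nat) : R :=
  if j == 0%N then 0 else lam j.

(* [lagrange n.+1 x] only reads x at the indices 0, ..., n. *)
Definition ell (R : realType) (n : nat) (lam : nat -> R) (i : 'I_n.+1) :
    {poly R} :=
  tnth (lagrange n.+1 (node lam)) i.

Definition Lambda (R : realType) (n : nat) (lam : nat -> R) (delta : R) : R :=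
  1 + \sum_(j < n.+1 | j != ord0) `|(ell lam j).[lam n + delta]|.

(* The library lemmas on [lagrange] require nodes that are injective on all of
   nat, whereas here only the nodes 0, ..., n are distinct. *)
Lemma ellE (R : realType) (n : nat) (lam : nat -> R) (i : 'I_n.+1) :
  ell lam i = let p := \prod_(j < n.+1 | j != i) ('X - (node lam j)%:P) in
    (p.[node lam i]^-1)%:P * p.
Proof.
rewrite /ell [lagrange _ _]unlock tnth_map /= npolypK ?tnth_ord_tuple //.
apply: (leq_trans (size_polyMleq _ _)).
have -> : size (\prod_(j < n.+1 | j != i) ('X - (node lam j)%:P)) = n.+1.
  rewrite size_prod => [|j _]; last by rewrite polyXsubC_eq0.
  rewrite (eq_bigr (fun=> 2%N)) => [|j _]; last by rewrite size_XsubC.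
  by rewrite sum_nat_const cardC1 card_ord /= muln2 -addnn -addSn addnK.
by rewrite addnS /= -[leqRHS]add1n leq_add2r size_polyC_leq1.
Qed.

Lemma ell_node (R : realType) (n : nat) (lam : nat -> R) (i j : 'I_n.+1) :
  injective (fun k : 'I_n.+1 => node lam k) ->
  (ell lam i).[node lam j] = (i == j)%:R.
Proof.
move=> node_inj; rewrite ellE /= hornerM hornerC.
set p := \prod_(_ < _ | _) _.
have [<-|neq_ij] := eqVneq i j.
  rewrite mulVf // horner_prod; apply/prodf_neq0 => k neq_ki.
  rewrite hornerXsubC subr_eq0; apply: contra neq_ki => /eqP e.
  by rewrite (node_inj _ _ e).
rewrite [X in _ * X]horner_prod (bigD1 j) 1?eq_sym //=.
by rewrite hornerXsubC subrr mul0r mulr0.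
Qed.

Lemma size_ell (R : realType) (n : nat) (lam : nat -> R) (i : 'I_n.+1) :
  (size (ell lam i) <= n.+1)%N.
Proof. exact: size_npoly. Qed.

(* Main.v *)
Require Import Defs.
From HB Require Import structures.
From mathcomp Require Import all_boot all_order all_algebra.
From mathcomp Require Import all_classical all_reals all_analysis.

Import Order.TTheory GRing.Theory Num.Theory.
Import numFieldNormedType.Exports.

Local Open Scope classical_set_scope.
Local Open Scope ring_scope.

(* Interpolate q at the n + 1 nodes and evaluate at y = lambda_n + delta, an
   endpoint of the last band: since q(0) = 1,
   l_0(y) = q(y) - \sum_(1 <= j <= n) q(lambda_j) l_j(y),
   and y and all the lambda_j lie in E, so that
   |l_0(y)| <= (max_E |q|) Lambda(delta). *)

(** The difference of the two sides has size at most [n.+1], yet vanishes at [n.+1] distinct nodes,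
    which a nonzero polynomial of that size cannot do. *)
Lemma lagrange_interpolation (R : realType) (n : nat) (lam : nat -> R)
    (q : {poly R}) :
  injective (fun k : 'I_n.+1 => node lam k) -> (size q <= n.+1)%N ->
  q = \sum_(j < n.+1) q.[node lam j] *: ell lam j.
Proof.
move=> node_inj sq; apply/eqP; rewrite -subr_eq0; apply/negPn/negP => p_neq0.
pose rs := [seq node lam (val k) | k <- enum 'I_n.+1].
have rs_uniq : uniq rs by rewrite map_inj_uniq ?enum_uniq.
have rs_root : all (root (q - \sum_(j < n.+1) q.[node lam j] *: ell lam j)) rs.
  apply/allP => _ /mapP[k _ ->]; rewrite rootE hornerD hornerN horner_sum.
  rewrite (bigD1 k) //= hornerZ ell_node // eqxx mulr1 big1 ?addr0 ?subrr //.
  by move=> j jk; rewrite hornerZ ell_node // (negbTE jk) mulr0.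
have := max_poly_roots p_neq0 rs_root rs_uniq.
rewrite size_map size_enum_ord ltnNge => /negP; apply.
rewrite (leq_trans (size_polyD _ _)) // geq_max sq size_polyN /=.
apply: (leq_trans (size_sum _ _ _)); apply/bigmax_leqP => j _.
by rewrite (leq_trans (size_scale_leq _ _)) ?size_ell.
Qed.

(** Compactness is what makes the maximum of |q| over E attained. Indexing the union by a finite
    list reduces it to compactness of each segment. *)
Lemma compact_bands (R : realType) (n : nat) (lam : nat -> R) (delta : R) :
  compact (bands n lam delta).
Proof.
have -> : bands n lam delta = \bigcup_(j in [set` index_iota 1 n.+1])
    `[lam j - delta, lam j + delta]%classic.
  by congr bigcup; apply/seteqP; split => j /=; rewrite mem_index_iota ltnS.
rewrite bigcup_seq; apply: big_ind => [|A B|j _].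
- exact: compact0.
- exact: compactU.
- exact: segment_compact.
Qed.

Section increasing_nodes.
Variables (R : realType) (n : nat) (lam : nat -> R).
Hypothesis n_gt0 : (0 < n)%N.
Hypothesis lam_gt0 : 0 < lam 1%N.
Hypothesis lam_incr : forall j : nat, (1 <= j < n)%N -> lam j < lam j.+1.

(** Stated for [node] rather than [lam], so that 0 heads the increasing chain: distinctness of the
    nodes, positivity of the [lam j] and their bound by [lam n] all follow from it. *)
Lemma node_lt (i j : nat) : (i < j <= n)%N -> node lam i < node lam j.
Proof.
elim: j => [|j IHj]; first by rewrite ltn0.
rewrite ltnS => /andP[]; rewrite leq_eqVlt => /predU1P[-> jn|ij jn].
  (* The first gap, from 0 to [lam 1], is [lam_gt0]; the later ones are [lam_incr]. *)
  case: j jn {IHj} => [|j] jn; rewrite /node ?eqxx //=.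
  by apply: lam_incr; rewrite jn.
apply: (@lt_trans _ _ (node lam j)); first by rewrite IHj // ij ltnW.
by case: j ij jn {IHj} => // j _ jn; rewrite /node /= lam_incr.
Qed.

Lemma node_inj : injective (fun k : 'I_n.+1 => node lam k).
Proof.
move=> i j eq_ij; apply: val_inj; case: (ltngtP i j) => // lt_ij.
- by have := @node_lt i j; rewrite lt_ij -ltnS ltn_ord eq_ij ltxx => /(_ isT).
- by have := @node_lt j i; rewrite lt_ij -ltnS ltn_ord eq_ij ltxx => /(_ isT).
Qed.

Lemma lam_pos (j : nat) : (0 < j <= n)%N -> 0 < lam j.
Proof. by case: j => // j jn; have := @node_lt 0 j.+1 jn. Qed.

Lemma lam_le_last (j : nat) : (0 < j <= n)%N -> lam j <= lam n.
Proof.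
case/andP => j_gt0; rewrite leq_eqVlt => /predU1P[->//|jn].
have := @node_lt j n; rewrite jn leqnn => /(_ isT).
by rewrite /node !gtn_eqF // => /ltW.
Qed.

Lemma Lambda_gt0 (delta : R) : 0 < Lambda n lam delta.
Proof. by rewrite ltr_pwDl ?sumr_ge0. Qed.

(** With y = [lam n + delta], l_0(y) is the product of the (y - lambda_j) / (0 - lambda_j). Since y
    >= lambda_n >= lambda_j > 0, each factor has absolute value y / lambda_j - 1. *)
Lemma ell0_pt (delta : R) : 0 <= delta ->
  `|(ell lam (@ord0 n)).[lam n + delta]| =
  delta / lam n * \prod_(1 <= j < n) ((lam n + delta) / lam j - 1).
Proof.
move=> delta_ge0; set y := lam n + delta.
have horner_prodX x : (\prod_(j < n.+1 | j != ord0) ('X - (node lam j)%:P)).[x]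
    = \prod_(1 <= j < n.+1) (x - lam j).
  rewrite horner_prod big_mkcond big_ord_recl eqxx /= mul1r big_add1 big_mkord.
  by apply: eq_bigr => j _; rewrite /= hornerXsubC.
rewrite ellE /= hornerM hornerC !horner_prodX {1}/node eqxx mulrC.
rewrite -prodf_div normr_prod.
have factorE j : (0 < j <= n)%N -> `|(y - lam j) / (0 - lam j)| = y / lam j - 1.
  move=> j_n; have j_pos := lam_pos _ j_n.
  rewrite normrM normfV sub0r normrN (gtr0_norm j_pos) ger0_norm.
    by rewrite mulrBl divff ?gt_eqF.
  by rewrite subr_ge0 (le_trans (lam_le_last _ j_n)) // lerDl.
(* The factor j = n is split off: y / lambda_n - 1 = delta / lambda_n. *)
rewrite big_nat_recr //= factorE ?n_gt0 ?leqnn // mulrC; congr (_ * _).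
  by rewrite /y mulrDl divff ?gt_eqF ?lam_pos ?n_gt0 ?leqnn // addrC addKr.
by apply: eq_big_nat => j /andP[j_gt0 jn]; rewrite factorE // j_gt0 ltnW.
Qed.

Lemma ell0_le (delta m : R) (q : {poly R}) :
  0 <= delta -> (size q <= n.+1)%N -> q.[0] = 1 ->
  (forall x, bands n lam delta x -> `|q.[x]| <= m) ->
  `|(ell lam (@ord0 n)).[lam n + delta]| <= m * Lambda n lam delta.
Proof.
move=> delta_ge0 sq q0 q_le; set y := lam n + delta.
have -> : (ell lam (@ord0 n)).[y] =
    q.[y] - \sum_(j < n.+1 | j != ord0) q.[lam j] * (ell lam j).[y].
  rewrite {1}(lagrange_interpolation _ _ _ q node_inj sq) horner_sum.
  rewrite (bigD1 ord0) //=.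
  rewrite hornerZ {1}/node eqxx q0 mul1r [X in _ + X - _](eq_bigr
    (fun j : 'I_n.+1 => q.[lam j] * (ell lam j).[y])) ?addrK // => j j_neq0.
  rewrite hornerZ /node -(inj_eq val_inj) /= in j_neq0 *.
  by rewrite (negbTE j_neq0).
(* The summand 1 of [Lambda] pays for |q(y)|, y being the right endpoint of band [n]; the other
   summands pay for the values q(lambda_j) at the band centres. *)
rewrite (le_trans (ler_normB _ _)) // mulrDr mulr1 lerD //.
  apply: q_le; exists n; first by rewrite /= n_gt0 leqnn.
  by rewrite /= in_itv /= lexx andbT lerD2l (le_trans _ delta_ge0) // oppr_le0.
rewrite (le_trans (ler_norm_sum _ _ _)) // mulr_sumr ler_sum // => j j_neq0.
rewrite normrM ler_wpM2r //; apply: q_le; exists (j : nat).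
  by rewrite /= leq_ord andbT lt0n.
by rewrite /= in_itv /= gerBl lerDl delta_ge0.
Qed.

(** [Lambda] is continuous in [delta], being built from absolute values of polynomials. At [delta] =
    0 the evaluation point is the node lambda_n, where l_n is 1 and every other l_j is 0, so the
    value is 1 + 1. *)
Lemma cvg_Lambda : Lambda n lam delta @[delta --> 0^'+] --> (2 : R).
Proof.
have Lambda0 : Lambda n lam 0 = 2.
  rewrite /Lambda addr0 (bigD1 ord_max) -?(inj_eq val_inj) -?lt0n //=.
  have nodeE : lam n = node lam (@ord_max n) by rewrite /node gtn_eqF.
  rewrite nodeE ell_node ?eqxx ?normr1; last exact: node_inj.
  rewrite big1 ?addr0 // => j /andP[_ j_max].
  by rewrite ell_node ?(negbTE j_max) ?normr0 //; exact: node_inj.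
rewrite -Lambda0; apply: cvg_at_right_filter.
apply: cvgD; first exact: cvg_cst.
apply: cvg_big => [|j _]; first exact: add_continuous.
apply: cvg_norm.
apply: (@cvg_comp _ _ _ (fun d : R => lam n + d) (fun x => (ell lam j).[x])).
  by apply: cvgD; [exact: cvg_cst | exact: cvg_id].
exact: continuous_horner.
Qed.

End increasing_nodes.

Theorem lemma2 (R : realType) (n : nat) (lam : nat -> R)
    (n_ge2 : (2 <= n)%N)
    (lam_gt0 : 0 < lam 1%N)
    (lam_incr : forall j : nat, (1 <= j < n)%N -> lam j < lam j.+1) :
  (forall delta : R,
     0 < delta < Num.min (lam 1%N) (2^-1 * min_gap n lam) ->
     (forall q : {poly R}, (size q <= n.+1)%N -> q.[0] = 1 ->
        exists2 m : R,
          is_max [set `|q.[x]| | x in bands n lam delta] m &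
          m >= `|(ell lam (@ord0 n)).[lam n + delta]| / Lambda n lam delta) /\
     `|(ell lam (@ord0 n)).[lam n + delta]| / Lambda n lam delta =
       delta / (lam n * Lambda n lam delta) *
       \prod_(1 <= j < n) ((lam n + delta) / lam j - 1)) /\
  Lambda n lam delta @[delta --> 0^'+] --> (2 : R).
Proof.
have n_gt0 : (0 < n)%N by exact: ltnW.
split; last exact: cvg_Lambda.
move=> delta /andP[delta_gt0 _]; have delta_ge0 := ltW delta_gt0.
split; last by rewrite ell0_pt // invfM mulrA mulrAC.
move=> q sq q0.
have bands_n0 : bands n lam delta !=set0.
  exists (lam n); exists n; first by rewrite /= n_gt0 leqnn.
  by rewrite /= in_itv /= gerBl lerDl delta_ge0.
(* By the extreme value theorem |q| attains its maximum over E at some [c]; the witness for [m] is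
   |q(c)|. *)
have [|c c_in c_max] := @compact_EVT_max _ _ (fun x : R => `|q.[x]|) _ bands_n0
    (@compact_bands _ n lam delta).
  apply: continuous_subspaceT => x; apply: cvg_norm; exact: continuous_horner.
have q_le x : bands n lam delta x -> `|q.[x]| <= `|q.[c]|.
  by move=> /mem_set; exact: c_max.
exists `|q.[c]|.
  split; first by exists c => //; exact: set_mem.
  by move=> _ [x + <-]; exact: q_le.
by rewrite ler_pdivrMr ?Lambda_gt0 //; exact: (ell0_le _ _ _ _ _ _ delta _ q).
Qed.
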